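(* Let $T_1$ and $T_2$ be two $2\times 2$ contingency tables. If weak odds ratio homogeneity (WORH) holds for $T_1$ and $T_2$, then Simpson's paradox does not hold for $T_1$ and $T_2$.
   Context: A $2\times 2$ contingency table $T=\begin{pmatrix} a & b\\ c& d\end{pmatrix}$ has entries that are positive real numbers; its odds ratio is $\kappa(T)=(ad)/(bc)$. For two such tables $T_i=\begin{pmatrix} a_i & b_i\\ c_i& d_i\end{pmatrix}$, $i=1,2$, the aggregated table $T_1+T_2$ is the entrywise sum. Weak odds ratio homogeneity (WORH) holds for $T_1$ and $T_2$ if $\kappa(T_1)=\kappa(T_1+T_2)$ or $\kappa(T_2)=\kappa(T_1+T_2)$. Put $A_i=\frac{a_i}{a_i+b_i}$, $C_i=\frac{c_i}{c_i+d_i}$ for $i=1,2$, and $\mu=\frac{a_1+a_2}{a_1+b_1+a_2+b_2}$, $\nu=\frac{c_1+c_2}{c_1+d_1+c_2+d_2}$. Simpson's paradox (SP) is said to occur (hold) for $T_1$ and $T_2$ if at least one of the following holds: (SP$_1$) $A_1>C_1$ and $A_2>C_2$ and not $(\mu>\nu)$; (SP$_2$) $A_1<C_1$ and $A_2<C_2$ and not $(\mu<\nu)$. *)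

(* Defs.v *)
From mathcomp Require Import all_boot all_order all_algebra.
From mathcomp Require Import reals.

Set Implicit Arguments.
Unset Strict Implicit.
Unset Printing Implicit Defensive.

Import Order.TTheory GRing.Theory Num.Theory.
Local Open Scope ring_scope.

(* A table with rows (a b) and (c d) is the matrix T with a = T 0 0,
   b = T 0 1, c = T 1 0, d = T 1 1 (indices in 'I_2); the aggregated
   table is the matrix sum T1 + T2. *)
Definition contingency_table (R : realType) (T : 'M[R]_2) : Prop :=
  forall i j, 0 < T i j.

Definition odds_ratio (R : realType) (T : 'M[R]_2) : R :=
  (T 0 0 * T 1 1) / (T 0 1 * T 1 0).

Definition WORH (R : realType) (T1 T2 : 'M[R]_2) : Prop :=
  odds_ratio T1 = odds_ratio (T1 + T2) \/ odds_ratio T2 = odds_ratio (T1 + T2).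

(* The proportions written A_i (first row) and C_i (second row). *)
Definition prop1 (R : realType) (T : 'M[R]_2) : R := T 0 0 / (T 0 0 + T 0 1).
Definition prop2 (R : realType) (T : 'M[R]_2) : R := T 1 0 / (T 1 0 + T 1 1).

(* The proportions mu (first row) and nu (second row). *)
Definition agg_prop1 (R : realType) (T1 T2 : 'M[R]_2) : R :=
  (T1 0 0 + T2 0 0) / (T1 0 0 + T1 0 1 + T2 0 0 + T2 0 1).
Definition agg_prop2 (R : realType) (T1 T2 : 'M[R]_2) : R :=
  (T1 1 0 + T2 1 0) / (T1 1 0 + T1 1 1 + T2 1 0 + T2 1 1).

Definition simpson_paradox (R : realType) (T1 T2 : 'M[R]_2) : Prop :=
  [/\ prop1 T1 > prop2 T1, prop1 T2 > prop2 T2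
    & ~ (agg_prop1 T1 T2 > agg_prop2 T1 T2)] \/
  [/\ prop1 T1 < prop2 T1, prop1 T2 < prop2 T2
    & ~ (agg_prop1 T1 T2 < agg_prop2 T1 T2)].

(* Main.v *)
(* In a positive table, A > C and A < C each say that ad - bc has a definite
   sign, i.e. that the odds ratio is above or below 1.  Since mu and nu are the
   proportions of T1 + T2, equality of the odds ratio of T1 + T2 with that of
   T1 or T2 transfers the common inequality to the aggregated table. *)
Require Import Defs.
From mathcomp Require Import all_boot all_order all_algebra.
From mathcomp Require Import reals.
From mathcomp Require Import lra.
Import Order.TTheory GRing.Theory Num.Theory.
Local Open Scope ring_scope.

Lemma contingency_tableD (R : realType) (T1 T2 : 'M[R]_2) :
  contingency_table T1 -> contingency_table T2 -> contingency_table (T1 + T2).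
Proof. by move=> h1 h2 i j; rewrite mxE addr_gt0. Qed.

Lemma agg_prop1E (R : realType) (T1 T2 : 'M[R]_2) :
  agg_prop1 T1 T2 = prop1 (T1 + T2).
Proof. by rewrite /agg_prop1 /prop1 !mxE addrACA !addrA. Qed.

Lemma agg_prop2E (R : realType) (T1 T2 : 'M[R]_2) :
  agg_prop2 T1 T2 = prop2 (T1 + T2).
Proof. by rewrite /agg_prop2 /prop2 !mxE addrACA !addrA. Qed.

(** Clearing the positive denominators gives [c(a+b) < a(c+d)] on one side and [bc < ad] on the
    other; they differ only by the common term [ac]. *)
Lemma prop2_lt_prop1 (R : realType) (T : 'M[R]_2) : contingency_table T ->
  (prop2 T < prop1 T) = (1 < odds_ratio T).
Proof.
move=> h; rewrite /prop1 /prop2 /odds_ratio.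
rewrite ltr_pdivrMr ?addr_gt0 // mulrAC ltr_pdivlMr ?addr_gt0 //.
rewrite ltr_pdivlMr ?mulr_gt0 // mul1r.
(* Linear once the products of entries are taken as atoms. *)
by apply/idP/idP; lra.
Qed.

Lemma prop1_lt_prop2 (R : realType) (T : 'M[R]_2) : contingency_table T ->
  (prop1 T < prop2 T) = (odds_ratio T < 1).
Proof.
move=> h; rewrite /prop1 /prop2 /odds_ratio.
rewrite ltr_pdivrMr ?addr_gt0 // mulrAC ltr_pdivlMr ?addr_gt0 //.
rewrite ltr_pdivrMr ?mulr_gt0 // mul1r.
by apply/idP/idP; lra.
Qed.

Theorem theorem6 (R : realType) (T1 T2 : 'M[R]_2)
    (hT1 : contingency_table T1) (hT2 : contingency_table T2)
    (hW : WORH T1 T2) :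
  ~ simpson_paradox T1 T2.
Proof.
have hT := contingency_tableD _ _ _ hT1 hT2.
rewrite /simpson_paradox agg_prop1E agg_prop2E.
rewrite !prop2_lt_prop1 // !prop1_lt_prop2 //.
(* The odds ratio of [T1 + T2] becomes that of [T1] or [T2], so the negated third conjunct
   contradicts the first or the second. *)
by case: hW => [<-|<-]; case=> -[].
Qed.
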